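(* Two computable probability measures on a constructive metric space are orthogonal if and only if they are effectively orthogonal.
   Context: A constructive metric space $(X,d,D,\alpha)$ is a complete separable metric space $(X,d)$ with a countable dense set $D$ and a numbering $\alpha:\mathbb{N}\to D$ such that $d(\alpha(m),\alpha(n))$ is computable uniformly in $m,n$. Basic balls are open balls with centres in $D$ and rational radii; effectively open sets are unions of enumerable families of basic balls. The probability measures $\mathcal{M}(X)$ form a constructive metric space with the Prokhorov distance and dense set the rational-valued measures with finite support in $D$ (naturally numbered); computable measures are computable points of this space (e.g. points for which the set of basic balls containing them is enumerable). A function $f:X\times\mathcal{M}(X)\to[0,\infty]$ is lower semicomputable if each $\{f>r\}$, $r$ rational, is a union of an enumerable family of products of basic balls, uniformly in $r$. A uniform test is such $f$ with $\int f(x,P)\,dP(x)\le1$ for all $P$; for a universal (maximal up to a constant factor) uniform test $\mathbf{t}$, $x$ is uniformly random w.r.t. $P$ if $\mathbf{t}(x,P)<\infty$. Measures $P,Q$ are orthogonal if $X$ splits into disjoint Borel sets $U,V$ with $P(V)=Q(U)=0$; they are effectively orthogonal if no point is uniformly random with respect to both. *)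

(* Defs.v *)
From HB Require Import structures.
From Stdlib Require Cantor.
From mathcomp Require Import all_boot all_order all_algebra.
From mathcomp Require Import all_classical all_reals all_analysis.

Set Implicit Arguments.
Unset Strict Implicit.
Unset Printing Implicit Defensive.

Import Order.TTheory GRing.Theory Num.Theory.
Import numFieldNormedType.Exports.

Local Open Scope classical_set_scope.
Local Open Scope ring_scope.

Definition npair (m n : nat) : nat := Cantor.to_nat (m, n).
Definition nfst (n : nat) : nat := (Cantor.of_nat n).1.
Definition nsnd (n : nat) : nat := (Cantor.of_nat n).2.

(* Total recursive functions, with minimization restricted to regular
   functions (so that no partial function is needed); several arguments are
   passed as one through Cantor's pairing. *)
Inductive recursive : (nat -> nat) -> Prop :=
| recursive_zero : recursive (fun _ => 0%N)
| recursive_succ : recursive S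
| recursive_fst : recursive nfst
| recursive_snd : recursive nsnd
| recursive_pair f g :
    recursive f -> recursive g -> recursive (fun x => npair (f x) (g x))
| recursive_comp f g :
    recursive f -> recursive g -> recursive (fun x => f (g x))
| recursive_prim f g h :
    recursive f -> recursive g ->
    (forall x, h (npair x 0) = f x) ->
    (forall x n, h (npair x n.+1) = g (npair x (npair n (h (npair x n))))) ->
    recursive h
| recursive_mu f h :
    recursive f ->
    (forall x, f (npair x (h x)) = 0%N) ->
    (forall x n, (n < h x)%N -> f (npair x n) <> 0%N) ->
    recursive h.

Definition enumerable (A : set nat) : Prop :=
  A = set0 \/ exists2 f, recursive f & range f = A.

(* The numbering <<a, b>, c> |-> (a - b) / (c + 1) of the rationals. *)
Definition rat_num (n : nat) : rat :=
  ((nfst (nfst n))%:R - (nsnd (nfst n))%:R) / (nsnd n).+1%:R.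

(* The basic ball of number <i, q>; it is empty when the radius is not
   positive. *)
Definition basic_ball (R : realType) (T : Type) (dist : T -> T -> R)
    (center : nat -> T) (n : nat) : set T :=
  [set x | dist x (center (nfst n)) < ratr (rat_num (nsnd n))].

Definition computable_point (R : realType) (T : Type) (dist : T -> T -> R)
    (center : nat -> T) (x : T) : Prop :=
  enumerable [set n | basic_ball dist center n x].

#[short(type="completeMetricType")]
HB.structure Definition CompleteMetric (R : numDomainType) :=
  {T of Complete T & Metric R T}.

(* The countable dense set is D = range alpha. *)
Record constructive_metric_space (R : realType) (X : completeMetricType R)
    (alpha : nat -> X) : Prop := {
  alpha_dense : dense (range alpha) ;
  alpha_computable : exists2 f, recursive f &
    forall m n k,
      `| mdist (alpha m) (alpha n) -
         ratr (rat_num (f (npair (npair m n) k))) | <= 2^-1 ^+ k :> R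
}.

Notation borel X := (g_sigma_algebraType (@open X)).

Definition Prob (R : realType) (X : completeMetricType R) : Type :=
  probability (borel X) R.

Section measures.
Context (R : realType) (X : completeMetricType R).
Local Open Scope ereal_scope.

Definition thickening (A : set (borel X)) (e : R) : set (borel X) :=
  [set y | exists2 x, A x & (mdist (x : X) (y : X) < e)%R].

Definition prokhorov (P Q : Prob X) : R :=
  inf [set e : R | (0 < e)%R /\
    forall A : set (borel X), measurable A ->
      P A <= Q (thickening A e) + e%:E /\ Q A <= P (thickening A e) + e%:E].

(* The number <k, s> codes the list of the first k entries of the stream
   obtained by repeatedly unpairing s; an entry <a, w> is an atom alpha(a)
   with integer weight w.  Weights are normalized to total mass 1, so that
   exactly the finitely supported measures with rational weights arise; if
   all weights vanish the result is the Dirac mass at alpha(0). *)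
Definition atom_entry (s i : nat) : nat := nfst (iter i nsnd s).

Definition finite_measure_of_code (alpha : nat -> X) (n : nat) :=
  msum (fun i => mscale ((nsnd (atom_entry (nsnd n) i))%:R%:nng)%R
                   (@dirac _ (borel X) (alpha (nfst (atom_entry (nsnd n) i))) R))
       (nfst n).

Definition prob_num (alpha : nat -> X) (n : nat) : Prob X :=
  mnormalize (finite_measure_of_code alpha n)
             (@dirac _ (borel X) (alpha 0%N) R).

Definition computable_measure (alpha : nat -> X) (P : Prob X) : Prop :=
  computable_point prokhorov (prob_num alpha) P.

(* Uniformity in the rational threshold: one enumerable set of pairs
   <r, <i, j>> serves for all r. *)
Definition lower_semicomputable (alpha : nat -> X)
    (f : X -> Prob X -> \bar R) : Prop :=
  exists2 W : set nat, enumerable W &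
    forall r : nat,
      [set xP : X * Prob X | (ratr (rat_num r))%:E < f xP.1 xP.2] =
      \bigcup_(n in [set n | W (npair r n)])
        (basic_ball (@mdist R X) alpha (nfst n) `*`
         basic_ball prokhorov (prob_num alpha) (nsnd n)).

Record uniform_test (alpha : nat -> X) (f : X -> Prob X -> \bar R) : Prop := {
  uniform_test_ge0 : forall x P, 0 <= f x P ;
  uniform_test_lsc : lower_semicomputable alpha f ;
  uniform_test_int : forall P : Prob X,
    \int[P]_(x in [set: borel X]) f x P <= 1
}.

Definition universal_uniform_test (alpha : nat -> X)
    (t : X -> Prob X -> \bar R) : Prop :=
  uniform_test alpha t /\
  forall f, uniform_test alpha f ->
    exists2 c : R, (0 < c)%R & forall x P, f x P <= c%:E * t x P.

Definition uniformly_random (t : X -> Prob X -> \bar R) (x : X) (P : Prob X)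
  : Prop := t x P < +oo.

Definition orthogonal_measures (P Q : Prob X) : Prop :=
  exists U V : set (borel X),
    [/\ measurable U, measurable V, U `|` V = setT, U `&` V = set0 &
        P V = 0 /\ Q U = 0].

Definition effectively_orthogonal (t : X -> Prob X -> \bar R) (P Q : Prob X)
  : Prop := ~ exists x, uniformly_random t x P /\ uniformly_random t x Q.

End measures.

(* Main.v *)
Require Import Defs.
From mathcomp Require Import all_boot all_order all_algebra.
From mathcomp Require Import all_classical all_reals all_analysis.
From mathcomp Require Import measurable_realfun lra zify.

(* If [P] and [Q] are orthogonal then, by outer regularity, for every [m] there
   is an open set of small [P]-measure whose complement has small [Q]-measure,
   and up to a small error this open set is a union of balls of a common radius
   [2^-k] with centers in a finite set [I] of points of [D].  A decidable
   approximate test for being close to [I] splits [D] into two parts, whose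
   [2^-k]-neighbourhoods [A_m] and [B_m] cover [X] and satisfy
   [P (A_m), Q (B_m) <= 2^-(2m+1)].  Finitely supported measures within [2^-k]
   of [P] and [Q] certify the two bounds by a finite computation, simultaneously
   for all measures in the Prokhorov balls around them.  Hence such data can be
   found recursively in [m], and
     [f (x, P') = sup {m | x in A_m and P' in the m-th ball}]
   is a uniform test, likewise for [B_m].  Each [x] lies in infinitely many
   [A_m] or in infinitely many [B_m], so one of the two tests is infinite at
   [(x, P)], resp. [(x, Q)].
   Conversely the set [t (_, P) = oo] separates [P] from [Q] when they are
   effectively orthogonal. *)

Set Implicit Arguments.
Unset Strict Implicit.
Unset Printing Implicit Defensive.

Import Order.TTheory GRing.Theory Num.Theory.

Local Open Scope classical_set_scope.
Local Open Scope ring_scope.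

(** * Recursive functions *)

Lemma nfst_pair a b : nfst (npair a b) = a.
Proof. by rewrite /nfst /npair Cantor.cancel_of_to. Qed.

Lemma nsnd_pair a b : nsnd (npair a b) = b.
Proof. by rewrite /nsnd /npair Cantor.cancel_of_to. Qed.

Definition npairE := (nfst_pair, nsnd_pair).

Lemma npair_nfst_nsnd n : npair (nfst n) (nsnd n) = n.
Proof. by rewrite /npair -surjective_pairing Cantor.cancel_to_of. Qed.

Lemma eq_recursive (f g : nat -> nat) : f =1 g -> recursive f -> recursive g.
Proof. by move=> /funext ->. Qed.

Lemma recursive_id : recursive id.
Proof.
apply: eq_recursive (recursive_pair recursive_fst recursive_snd).
exact: npair_nfst_nsnd.
Qed.

Lemma recursive_const c : recursive (fun=> c).
Proof.
elim: c => [|c IH]; first exact: recursive_zero.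
exact: (recursive_comp recursive_succ IH).
Qed.

Definition recursive2 (F : nat -> nat -> nat) : Prop :=
  recursive (fun x => F (nfst x) (nsnd x)).

Lemma recursive2_comp F f g : recursive2 F -> recursive f -> recursive g ->
  recursive (fun x => F (f x) (g x)).
Proof.
move=> rF rf rg; apply: eq_recursive (recursive_comp rF (recursive_pair rf rg)).
by move=> x; rewrite !npairE.
Qed.

(* A head symbol applied to arguments depending on the variable is split off
   by composition; the boolean variants see through the coercion to [nat]. *)
Create HintDb recursive.
Local Ltac prove_recursive := solve [auto 20 with recursive].
#[local] Hint Resolve recursive_id recursive_const recursive_succ recursive_fst
  recursive_snd recursive_pair : recursive.
#[local] Hint Extern 1 (recursive2 _) => red; cbv beta : recursive.
#[local] Hint Extern 2 (recursive (fun x => ?F (@?f x))) =>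
  apply (@recursive_comp F f) : recursive.
#[local] Hint Extern 2 (recursive (fun x => ?F (@?f x) (@?g x))) =>
  apply (@recursive2_comp F f g) : recursive.
#[local] Hint Extern 2
    (recursive (fun x => nat_of_bool (?p (@?f x) (@?g x)))) =>
  apply (@recursive2_comp (fun a b => nat_of_bool (p a b)) f g) : recursive.

Lemma recursive_nat_rect (f h : nat -> nat) (G : nat -> nat -> nat -> nat) :
  recursive f -> recursive h ->
  recursive2 (fun x y => G x (nfst y) (nsnd y)) ->
  recursive (fun x => nat_rect (fun=> nat) (f x) (G x) (h x)).
Proof.
move=> rf rh rG; pose F x n := nat_rect (fun=> nat) (f x) (G x) n.
apply: (@recursive2_comp F) recursive_id rh.
by apply: (recursive_prim rf rG) => x *; rewrite !npairE.
Qed.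
#[local] Hint Resolve recursive_nat_rect : recursive.

Lemma recursive_iter (g f h : nat -> nat) :
  recursive g -> recursive f -> recursive h ->
  recursive (fun x => iter (h x) g (f x)).
Proof.
move=> rg rf rh.
have : recursive (fun x => nat_rect (fun=> nat) (f x) (fun=> g) (h x)).
  by prove_recursive.
by apply: eq_recursive => x; elim: (h x) => //= n ->.
Qed.
#[local] Hint Resolve recursive_iter : recursive.

Lemma recursive_addn f g : recursive f -> recursive g ->
  recursive (fun x => f x + g x)%N.
Proof.
move=> rf rg.
have : recursive (fun x => iter (f x) S (g x)) by prove_recursive.
by apply: eq_recursive => x; elim: (f x) => //= n ->.
Qed.
#[local] Hint Resolve recursive_addn : recursive.

Lemma recursive_sum (F : nat -> nat -> nat) h : recursive2 F -> recursive h ->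
  recursive (fun x => \sum_(i < h x) F x i)%N.
Proof.
move=> rF rh.
have : recursive (fun x =>
    nat_rect (fun=> nat) 0%N (fun i s => s + F x i)%N (h x)).
  by prove_recursive.
apply: eq_recursive => x.
by elim: (h x) => [|n IH] /=; rewrite ?big_ord0// big_ord_recr -IH.
Qed.
#[local] Hint Resolve recursive_sum : recursive.

Lemma recursive_muln f g : recursive f -> recursive g ->
  recursive (fun x => f x * g x)%N.
Proof.
move=> rf rg.
have : recursive (fun x => \sum_(i < f x) g x)%N.
  by apply: (@recursive_sum (fun x _ => g x)); prove_recursive.
by apply: eq_recursive => x; rewrite sum_nat_const card_ord.
Qed.
#[local] Hint Resolve recursive_muln : recursive.

Lemma recursive_predn : recursive predn.
Proof.
have : recursive (fun x => nat_rect (fun=> nat) 0%N (fun i _ => i) x).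
  by prove_recursive.
by apply: eq_recursive => -[].
Qed.
#[local] Hint Resolve recursive_predn : recursive.

Lemma recursive_subn f g : recursive f -> recursive g ->
  recursive (fun x => f x - g x)%N.
Proof.
move=> rf rg.
have : recursive (fun x => iter (g x) predn (f x)) by prove_recursive.
apply: eq_recursive => x.
by elim: (g x) => [|n] /=; [rewrite subn0|move=> ->; rewrite subnS].
Qed.
#[local] Hint Resolve recursive_subn : recursive.

Lemma recursive_expn f g : recursive f -> recursive g ->
  recursive (fun x => f x ^ g x)%N.
Proof.
move=> rf rg; have : recursive (fun x =>
    nat_rect (fun=> nat) 1%N (fun _ y => f x * y)%N (g x)).
  by prove_recursive.
by apply: eq_recursive => x; elim: (g x) => //= n ->; rewrite expnS.
Qed.
#[local] Hint Resolve recursive_expn : recursive.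

Lemma recursive_leq f g : recursive f -> recursive g ->
  recursive (fun x => f x <= g x)%N.
Proof.
move=> rf rg; have : recursive (fun x => 1 - (f x - g x))%N.
  by prove_recursive.
by apply: eq_recursive => x; rewrite -subn_eq0; case: (f x - g x)%N.
Qed.
#[local] Hint Resolve recursive_leq : recursive.

Lemma recursive_negb (p : pred nat) :
  recursive p -> recursive (fun x => ~~ p x).
Proof.
move=> rp; have : recursive (fun x => 1 - p x)%N by prove_recursive.
by apply: eq_recursive => x; case: (p x).
Qed.
#[local] Hint Resolve recursive_negb : recursive.

Lemma recursive_andb (p q : pred nat) :
  recursive p -> recursive q -> recursive (fun x => p x && q x).
Proof.
move=> rp rq; have : recursive (fun x => p x * q x)%N by prove_recursive.
by apply: eq_recursive => x; rewrite mulnb.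
Qed.
#[local] Hint Resolve recursive_andb : recursive.

Lemma recursive_orb (p q : pred nat) :
  recursive p -> recursive q -> recursive (fun x => p x || q x).
Proof.
move=> rp rq; have : recursive (fun x => ~~ (~~ p x && ~~ q x)).
  by prove_recursive.
by apply: eq_recursive => x; rewrite negb_and !negbK.
Qed.
#[local] Hint Resolve recursive_orb : recursive.

Lemma recursive_eqn f g : recursive f -> recursive g ->
  recursive (fun x => f x == g x).
Proof.
move=> rf rg; have : recursive (fun x => (f x <= g x) && (g x <= f x))%N.
  by prove_recursive.
by apply: eq_recursive => x; rewrite eqn_leq.
Qed.
#[local] Hint Resolve recursive_eqn : recursive.

Lemma recursive_if (p : pred nat) f g :
  recursive p -> recursive f -> recursive g ->
  recursive (fun x => if p x then f x else g x).
Proof.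
move=> rp rf rg; have : recursive (fun x => p x * f x + ~~ p x * g x)%N.
  by prove_recursive.
by apply: eq_recursive => x; case: (p x); rewrite /= ?mul1n ?mul0n ?addn0.
Qed.
#[local] Hint Resolve recursive_if : recursive.

Lemma recursive_has (p : nat -> pred nat) h :
  recursive2 (fun x i => p x i) -> recursive h ->
  recursive (fun x => has (p x) (iota 0 (h x))).
Proof.
move=> rp rh; have := recursive_leq (recursive_const 1) (recursive_sum rp rh).
apply: eq_recursive => x; rewrite has_count -sum1_count [in RHS]big_mkcond /=.
rewrite -(big_mkord xpredT (fun i => p x i : nat)) /index_iota subn0.
by congr (nat_of_bool (0 < _)%N); apply: eq_bigr => i _; case: (p x i).
Qed.
#[local] Hint Resolve recursive_has : recursive.

Lemma enumerableP (A : set nat) : enumerable A <->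
  exists2 p : nat -> pred nat,
    recursive2 (fun x y => p x y) & A = [set x | exists y, p x y].
Proof.
split=> [[->|[f rf <-]]|[p rp ->]].
- exists (fun _ _ => false); first by prove_recursive.
  by apply/seteqP; split => // x [].
- exists (fun x y => f y == x); first by prove_recursive.
  apply/seteqP; split=> x [y]; first by move=> _ <-; exists y.
  by move=> /eqP; exists y.
have [->|/set0P[w [z pwz]]] := eqVneq [set x | exists y, p x y] set0.
  by left.
right; exists (fun y => if p (nfst y) (nsnd y) then nfst y else w).
  by prove_recursive.
apply/seteqP; split => x /=.
  by move=> [y _ <-]; case: ifP => [py|_]; [exists (nsnd y)|exists z].
by move=> [y pxy]; exists (npair x y); rewrite ?npairE ?pxy.
Qed.

Lemma recursive_selection (p : nat -> pred nat) :
  recursive2 (fun x y => p x y) -> (forall x, exists y, p x y) ->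
  exists2 h, recursive h & forall x, p x (h x).
Proof.
move=> rp pex; exists (fun x => ex_minn (pex x)) => [|x];
  last by case: ex_minnP.
apply: (recursive_mu (recursive_negb rp)) => [x|x n]; rewrite !npairE.
  by case: ex_minnP => y ->.
by case: ex_minnP => y _ ymin ny; case: (boolP (p x n)) => // /ymin; lia.
Qed.

(** * Numberings of rationals, finite lists and finitely supported measures *)

Section numberings.
Local Open Scope nat_scope.

Definition radius_code (k : nat) : nat := npair (npair 1 0) (2 ^ k).-1.

Lemma recursive_radius_code : recursive radius_code.
Proof. by rewrite /radius_code; prove_recursive. Qed.

Definition rat_lt_dyadic (n L k : nat) : bool :=
  nfst (nfst n) * 2 ^ k < nsnd (nfst n) * 2 ^ k + L * (nsnd n).+1.

Lemma recursive_rat_lt_dyadic n L k :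
  recursive n -> recursive L -> recursive k ->
  recursive (fun x => rat_lt_dyadic (n x) (L x) (k x)).
Proof. by move=> rn rL rk; rewrite /rat_lt_dyadic; prove_recursive. Qed.

Lemma recursive2_atom_entry : recursive2 atom_entry.
Proof. by rewrite /recursive2 /atom_entry; prove_recursive. Qed.
#[local] Hint Resolve recursive2_atom_entry : recursive.

Definition weight (n i : nat) : nat := nsnd (atom_entry (nsnd n) i).
Definition atom (n i : nat) : nat := nfst (atom_entry (nsnd n) i).

Definition weight_in (p : pred nat) (n : nat) : nat :=
  \sum_(i < nfst n | p (atom n i)) weight n i.

Definition total_weight : nat -> nat := weight_in xpredT.

Lemma recursive_weight_in (p : nat -> pred nat) n :
  recursive2 (fun x a => p x a) -> recursive n ->
  recursive (fun x => weight_in (p x) (n x)).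
Proof.
move=> rp rn.
have : recursive (fun x => \sum_(i < nfst (n x))
    if p x (atom (n x) i) then weight (n x) i else 0).
  apply: (@recursive_sum (fun x i =>
    if p x (atom (n x) i) then weight (n x) i else 0)); last by prove_recursive.
  by rewrite /recursive2 /atom /weight; prove_recursive.
by apply: eq_recursive => x; rewrite -big_mkcond.
Qed.

Lemma recursive_total_weight : recursive total_weight.
Proof. by apply: (@recursive_weight_in (fun=> xpredT)); prove_recursive. Qed.

Lemma leq_weight_in (p q : pred nat) n :
  subpred p q -> weight_in p n <= weight_in q n.
Proof.
move=> pq; rewrite /weight_in big_mkcond [leqRHS]big_mkcond /=.
apply: leq_sum => i _; case: ifPn => [/pq ->//|//].
Qed.

Lemma atom_entry_surj (N : nat) (f : nat -> nat) :
  exists s, forall i, i < N -> atom_entry s i = f i.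
Proof.
elim: N f => [|N IH] f; first by exists 0.
have [s sf] := IH (fun i => f i.+1).
exists (npair (f 0) s) => -[_|i iN].
  by rewrite /atom_entry /= nfst_pair.
by rewrite /atom_entry iterSr nsnd_pair; exact: sf.
Qed.

Lemma weight_in_surj (N : nat) (a w : nat -> nat) :
  exists n, forall p, weight_in p n = \sum_(i < N | p (a i)) w i.
Proof.
have [s sE] := atom_entry_surj N (fun i => npair (a i) (w i)).
exists (npair N s) => p; rewrite /weight_in /weight /atom !npairE.
by apply: eq_big => [i|i _]; rewrite sE// npairE.
Qed.

(* A finite list is coded like the atoms of a finitely supported measure. *)
Definition listed (I : nat) : set nat :=
  [set c | exists2 j, j < nfst I & atom_entry (nsnd I) j = c].

Lemma listed_surj (A : set nat) : finite_set A -> exists I, listed I = A.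
Proof.
move=> /finite_seqP[s ->].
have [t tE] := atom_entry_surj (size s) (nth 0 s).
exists (npair (size s) t); rewrite /listed !npairE.
apply/seteqP; split => c /= => [[j js <-]|cs]; first by rewrite tE// mem_nth.
by exists (index c s); rewrite ?index_mem// tE ?index_mem// nth_index.
Qed.

Lemma rat_num_surj (q : rat) : exists n, rat_num n = q.
Proof.
have [d dE] : exists d, denq q = d.+1%:Z.
  by case: (denq q) (denq_gt0 q) => // -[|d] //; exists d.
have -> : q = ((numq q)%:~R / d.+1%:R)%R by rewrite -{1}[q]divq_num_den dE.
case: (numq q) => a.
  by exists (npair (npair a 0) d); rewrite /rat_num !npairE subr0 -pmulrn.
exists (npair (npair 0 a.+1) d).
by rewrite /rat_num !npairE sub0r NegzE mulrNz -pmulrn.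
Qed.

End numberings.
#[local] Hint Resolve recursive_radius_code recursive_rat_lt_dyadic
  recursive2_atom_entry recursive_weight_in recursive_total_weight : recursive.

Section ratr_rat_num.
Variable R : realType.

Lemma ratr_rat_numE (n : nat) : ratr (rat_num n) =
  ((nfst (nfst n))%:R - (nsnd (nfst n))%:R) / (nsnd n).+1%:R :> R.
Proof. by rewrite /rat_num rmorphM fmorphV rmorphB !rmorph_nat. Qed.

Lemma rat_lt_dyadicE (n L k : nat) :
  rat_lt_dyadic n L k = (ratr (rat_num n) < L%:R * 2^-1 ^+ k :> R).
Proof.
rewrite ratr_rat_numE exprVn ltr_pdivrMr ?ltr0n// mulrAC.
rewrite ltr_pdivlMr ?exprn_gt0//.
by rewrite mulrBl ltrBlDl /rat_lt_dyadic -(ltr_nat R) natrD !natrM natrX.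
Qed.

Lemma ratr_radius_code (k : nat) :
  ratr (rat_num (radius_code k)) = 2^-1 ^+ k :> R.
Proof.
rewrite ratr_rat_numE !npairE subr0 prednK ?expn_gt0// natrX exprVn.
by rewrite mul1r.
Qed.

End ratr_rat_num.

(** * Regularity of Borel measures *)

Lemma half_exp_lt (R : archiRealFieldType) (e : R) :
  0 < e -> exists k, 2^-1 ^+ k < e.
Proof.
move=> e0.
have [k _ /(_ k (leqnn k))] := near_infty_natSinv_expn_lt (PosNum e0).
by rewrite /= div1r -exprVn; exists k.
Qed.

Lemma half_exp_le (R : realFieldType) (m n : nat) :
  (m <= n)%N -> 2^-1 ^+ n <= 2^-1 ^+ m :> R.
Proof. by move=> mn; apply: ler_wiXn2l => //; lra. Qed.

Lemma half_exp_mul_le (R : archiRealFieldType) (L e : R) (M : nat) :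
  0 < L -> 0 < e -> exists2 k, (M <= k)%N & L * 2^-1 ^+ k <= e.
Proof.
move=> L0 e0; have [j je] := half_exp_lt (divr_gt0 e0 L0).
exists (maxn M j); first exact: leq_maxl.
rewrite mulrC -ler_pdivlMr//; apply: le_trans (ltW je).
by rewrite half_exp_le// leq_maxr.
Qed.

Lemma half_exp_split (R : realFieldType) (n : nat) :
  2^-1 ^+ n = 2^-1 ^+ n.+1 + 2^-1 ^+ n.+1 :> R.
Proof. by rewrite exprS; lra. Qed.

Lemma nondecreasing_measure_setD_lt d (T : measurableType d) (R : realType)
    (mu : {finite_measure set T -> \bar R}) (F : (set T)^nat) (e : R) :
  (forall n, measurable (F n)) -> nondecreasing_seq F -> 0 < e ->
  exists n, (mu (\bigcup_n F n `\` F n) < e%:E)%E.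
Proof.
move=> mF iF e0; pose G n := \bigcup_n F n `\` F n.
have mG n : measurable (G n).
  by apply: measurableD => //; exact: bigcupT_measurable.
have G0 : \bigcap_n G n = set0.
  rewrite -subset0 => x Gx; have [[n _ Fnx] _] := Gx 0%N I.
  by have [_] := Gx n I; apply.
have : mu \o G @ \oo --> mu (\bigcap_n G n).
  apply: nonincreasing_cvg_mu => //.
  - by rewrite -ge0_fin_numE// fin_num_measure.
  - by rewrite G0.
  - by move=> m n mn; apply/subsetPset; apply: setDS; apply/subsetPset/iF.
rewrite G0 measure0 => /(_ [set z | z < e%:E]%E) [].
  apply: open_nbhs_nbhs; split; last by rewrite /= lte_fin.
  exact: open_ereal_lt_ereal.
by move=> n _ /(_ n (leqnn n)); exists n.
Qed.

Lemma measure_setD_bigcup_II_lt d (T : measurableType d) (R : realType)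
    (mu : {finite_measure set T -> \bar R}) (F : (set T)^nat) (e : R) :
  (forall n, measurable (F n)) -> 0 < e ->
  exists n, (mu (\bigcup_i F i `\` \bigcup_(i in `I_n) F i) < e%:E)%E.
Proof.
move=> mF; pose G n := \bigcup_(i in `I_n) F i.
have mG n : measurable (G n) by apply: bigcup_measurable => *.
have iG : nondecreasing_seq G.
  move=> i j ij; apply/subsetPset; apply: bigcup_subset => k /= /leq_trans.
  exact.
rewrite (_ : \bigcup_i F i = \bigcup_n G n).
  exact: nondecreasing_measure_setD_lt.
apply/seteqP; split=> [x [n _ Fn]|x [n _ [i _ Fi]]]; last by exists i.
by exists n.+1 => //; exists n => /=.
Qed.

Section borel_sets.
Context (X : ptopologicalType).

Lemma borel_open (A : set X) : open A -> measurable (A : set (borel X)).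
Proof. exact: sub_sigma_algebra. Qed.

Lemma borel_closed (A : set X) : closed A -> measurable (A : set (borel X)).
Proof.
move=> cA; rewrite -[A]setCK; apply: measurableC.
by apply: borel_open; exact: closed_openC.
Qed.

Lemma lower_semicontinuous_borel_measurable (R : realType) (f : X -> \bar R) :
  lower_semicontinuous f ->
  measurable_fun [set: borel X] (f : borel X -> \bar R).
Proof.
move=> /lower_semicontinuousP open_gt.
apply: (measurability _ (ErealGenOInfty.measurableE R)).
move=> _ [_ [a ->]] <-; apply: measurableI => //.
by rewrite preimage_itvoy; exact: borel_open.
Qed.

End borel_sets.

Lemma open_mdistP (K : numDomainType) (X : metricType K) (A : set X) :
  open A <-> forall x, A x ->
    exists2 e : K, 0 < e & forall y, mdist x y < e -> A y.
Proof.
rewrite openE; split=> [oA x /oA /nbhs_ballP[e /= e0 eA]|oA x /oA[e e0 eA]].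
  by exists e => // y xy; apply: eA; rewrite ballEmdist.
by apply/nbhs_ballP; exists e => // y; rewrite ballEmdist; exact: eA.
Qed.

Section thickening.
Context (R : realType) (X : completeMetricType R).
Implicit Types (A : set (borel X)) (d e : R).

Lemma open_thickening A e : open (thickening A e : set X).
Proof.
apply/open_mdistP => y [x Ax xy]; exists (e - mdist x y).
  by rewrite subr_gt0.
move=> z yz; exists x => //; apply: le_lt_trans (metric_triangle x y z) _.
by rewrite -ltrBrDl.
Qed.

Lemma measurable_thickening A e : measurable (thickening A e).
Proof. by apply: borel_open; exact: open_thickening. Qed.

Lemma le_thickening A d e : d <= e -> thickening A d `<=` thickening A e.
Proof. by move=> de y [x Ax xy]; exists x => //; exact: lt_le_trans de. Qed.

Lemma subset_thickening A e : 0 < e -> A `<=` thickening A e.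
Proof. by move=> e0 x Ax; exists x => //; rewrite mdistxx. Qed.

Lemma thickening_thickening A d e :
  thickening (thickening A d) e `<=` thickening A (d + e).
Proof.
move=> y [x [z Az zx] xy]; exists z => //.
by apply: le_lt_trans (metric_triangle z x y) _; exact: ltrD.
Qed.

Lemma thickening_setCE A e :
  ~` thickening (~` A) e = [set x | thickening [set x] e `<=` A].
Proof.
apply/seteqP; split=> x /= xA.
  move=> y [_ -> xy]; apply: contrapT => Ay; apply: xA; exists y => //.
  by rewrite metric_sym.
by move=> [y Ay]; rewrite metric_sym => yx; apply: Ay; apply: xA; exists x.
Qed.

Lemma open_bigcup_thickening_setC (A : set X) : open A ->
  \bigcup_n ~` thickening (~` A) (2^-1 ^+ n) = A.
Proof.
move=> /open_mdistP oA; apply/seteqP; split=> x.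
  move=> [n _]; rewrite thickening_setCE; apply.
  by apply: subset_thickening; rewrite ?exprn_gt0.
move=> /oA[e e0 eA]; have [n ne] := half_exp_lt e0; exists n => //.
rewrite thickening_setCE => y [_ -> xy]; apply: eA; exact: lt_trans ne.
Qed.

Lemma nondecreasing_thickening_setC A :
  nondecreasing_seq (fun n => ~` thickening (~` A) (2^-1 ^+ n)).
Proof.
move=> m n mn; apply/subsetPset; apply: subsetC; apply: le_thickening.
exact: half_exp_le.
Qed.

End thickening.

Section regularity.
Context (R : realType) (X : completeMetricType R).
Variable mu : {finite_measure set (borel X) -> \bar R}.
Local Open Scope ereal_scope.

Definition regular_set (A : set (borel X)) : Prop := forall e : R, (0 < e)%R ->
  exists F W : set X, [/\ closed F, open W, F `<=` A, A `<=` W &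
    mu (W `\` F : set (borel X)) < e%:E].

Lemma regular_open (A : set X) : open A -> regular_set A.
Proof.
move=> oA e e0; pose F n : set X := ~` thickening (~` A) (2^-1 ^+ n).
have mF n : measurable (F n : set (borel X)).
  by apply: measurableC; exact: measurable_thickening.
have [n] := nondecreasing_measure_setD_lt mu mF
  (@nondecreasing_thickening_setC _ _ A) e0.
rewrite open_bigcup_thickening_setC// => Fn; exists (F n), A; split => //.
- by apply: open_closedC; exact: open_thickening.
- by rewrite -[X in _ `<=` X](open_bigcup_thickening_setC oA) => x; exists n.
Qed.

Lemma regular_setC A : regular_set A -> regular_set (~` A).
Proof.
move=> rA e /rA[F [W [cF oW FA AW WF]]]; exists (~` W), (~` F); split.
- exact: open_closedC.
- exact: closed_openC.
- exact: subsetC.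
- exact: subsetC.
- by rewrite setDE setCK setIC -setDE.
Qed.

Lemma regular_bigcup (A : (set (borel X))^nat) :
  (forall n, regular_set (A n)) -> regular_set (\bigcup_n A n).
Proof.
move=> rA e e0; have e20 : (0 < e / 2)%R by rewrite divr_gt0.
have e2n0 n : (0 < e / 2 / (2 ^ n)%:R)%R by rewrite divr_gt0// ltr0n expn_gt0.
have {rA}[F rA] := choice (fun n => rA n _ (e2n0 n.+2)).
have {rA}[W /all_and5[cF oW FA AW WF]] := choice rA.
have mF n : measurable (F n : set (borel X)) by exact: borel_closed.
have [n Fn] := measure_setD_bigcup_II_lt mu mF (e2n0 1%N).
pose G : set (borel X) := \bigcup_(i in `I_n) F i.
have mG : measurable G by apply: bigcup_measurable => *.
pose D k := if k is i.+1 then W i `\` F i else \bigcup_n F n `\` G.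
have mD k : measurable (D k : set (borel X)).
  case: k => [|k]; apply: measurableD => //; last by apply: borel_open.
  exact: bigcupT_measurable.
have mW : measurable (\bigcup_i W i : set (borel X)).
  by apply: bigcupT_measurable => i; exact: borel_open.
exists G, (\bigcup_i W i); split => //.
- by apply: closed_bigcup => [|i _]; [exact: finite_II|exact: cF].
- by apply: bigcup_open => i _; exact: oW.
- by move=> x [i _ /FA]; exists i.
- exact: subset_bigcup.
have cover : \bigcup_i W i `\` G `<=` \bigcup_k D k.
  move=> x [[i _ Wi] Gx]; have [Fi|Fi] := pselect ((\bigcup_i F i) x).
    by exists 0%N.
  by exists i.+1 => //; split => // Fix; apply: Fi; exists i.
apply: le_lt_trans (measure_sigma_subadditive mu mD _ cover) _.
  exact: measurableD.
apply: (@le_lt_trans _ _ (e / 2)%:E); last by rewrite lte_fin; lra.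
apply: le_trans (epsilon_trick0 xpredT (ltW e20)).
apply: lee_nneseries => // -[|k] _; first exact: ltW.
exact/ltW/WF.
Qed.

Lemma borel_regular A : measurable A -> regular_set A.
Proof.
move: A; apply: smallest_sub; last exact: regular_open.
split.
- by move=> e e0; exists set0, set0; split => //;
    [exact: closed0|exact: open0|rewrite setD0 measure0 lte_fin].
- by move=> A rA; rewrite setTD; exact: regular_setC.
- by move=> A rA; exact: regular_bigcup.
Qed.

Lemma borel_outer_regular (A : set (borel X)) (e : R) :
  measurable A -> (0 < e)%R ->
  exists W : set X, [/\ open W, A `<=` W & mu (W `\` A : set (borel X)) < e%:E].
Proof.
move=> mA /(borel_regular mA)[F [W [cF oW FA AW WF]]]; exists W; split => //.
apply: le_lt_trans WF; apply: le_measure; rewrite ?inE//.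
- by apply: measurableD => //; exact: borel_open.
- by apply: measurableD; [exact: borel_open|exact: borel_closed].
- exact: setDS.
Qed.

End regularity.

(** * The Prokhorov distance *)

Section prokhorov.
Context (R : realType) (X : completeMetricType R).
Implicit Types (P Q : Prob X) (A : set (borel X)) (e : R).
Local Open Scope ereal_scope.

Lemma prokhorovC P Q : prokhorov P Q = prokhorov Q P.
Proof.
rewrite /prokhorov; congr inf; apply/seteqP.
by split => e [e0 PQ]; split => // A /PQ[].
Qed.

(* Applying the inequality to the complement of the thickening of [A] gives
   the symmetric one. *)
Lemma prokhorov_le P Q e : (0 < e)%R ->
  (forall A, measurable A -> P A <= Q (thickening A e) + e%:E) ->
  (prokhorov P Q <= e)%R.
Proof.
move=> e0 PQ; apply: ge_inf; first by exists 0%R => d /= [/ltW].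
split => // A mA; split; first exact: PQ.
have mT (B : set (borel X)) := measurable_thickening B e.
have := PQ (~` thickening A e) (measurableC (mT A)).
have : Q (thickening (~` thickening A e) e) <= Q (~` A).
  apply: le_measure; rewrite ?inE//; first exact: measurableC.
  move=> y [x] /= xA xy Ay; apply: xA; exists y => //.
  by rewrite metric_sym.
rewrite !probability_setC//.
rewrite -(fineK (fin_num_measure P _ (mT A))).
rewrite -(fineK (fin_num_measure Q _ (mT (~` thickening A e)))).
rewrite -(fineK (fin_num_measure Q _ mA)) -!EFinB -!EFinD !lee_fin.
by set a := fine _; set b := fine _; set c := fine _ => ? ?; lra.
Qed.

Lemma probability_le_add1 P Q A B : measurable A -> P A <= Q B + 1.
Proof.
by move=> mA; rewrite -[X in X <= _]add0e leeD//; exact: probability_le1.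
Qed.

Lemma prokhorov_le1 P Q : (prokhorov P Q <= 1)%R.
Proof. by apply: prokhorov_le => // A mA; exact: probability_le_add1. Qed.

Lemma prokhorov_lt P Q e A : (prokhorov P Q < e)%R -> measurable A ->
  P A <= Q (thickening A e) + e%:E.
Proof.
move=> /inf_lt[|d /= [_ PQ] de mA].
  by exists 1%R; split => // B mB; split; exact: probability_le_add1.
apply: le_trans (PQ A mA).1 _; apply: leeD; last by rewrite lee_fin ltW.
apply: le_measure; rewrite ?inE; [exact: measurable_thickening..|].
exact: le_thickening (ltW de).
Qed.

End prokhorov.

(** * Finitely supported measures *)

Section nearby.
Context (R : realType) (X : completeMetricType R) (alpha : nat -> X).
Implicit Types (I J : set nat) (e : R) (x : X).
Local Open Scope ereal_scope.

Definition nearby I e : set (borel X) :=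
  thickening (alpha @` I : set (borel X)) e.

Lemma nearbyP I e x :
  nearby I e x <-> exists2 c, I c & (mdist (alpha c) x < e)%R.
Proof.
split=> [[_ [c Ic <-] cx]|[c Ic cx]]; first by exists c.
by exists (alpha c) => //; exists c.
Qed.

Lemma measurable_nearby I e : measurable (nearby I e).
Proof. exact: measurable_thickening. Qed.

Lemma subset_nearby I J e : I `<=` J -> nearby I e `<=` nearby J e.
Proof. by move=> IJ x /nearbyP[c /IJ Jc cx]; apply/nearbyP; exists c. Qed.

Lemma nearby_bigcup I e : nearby I e = \bigcup_(c in I) nearby [set c] e.
Proof.
apply/seteqP; split=> x => [/nearbyP[c Ic cx]|[c Ic] /nearbyP[_ -> cx]].
  by exists c => //; apply/nearbyP; exists c.
by apply/nearbyP; exists c.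
Qed.

Lemma eroded_nearby_subset J (W : set X) (d e r : R) : (d + e <= r)%R ->
  ~` thickening (~` W) r `&` nearby J e `<=`
  nearby (J `&` [set c | nearby [set c] d `<=` W]) e.
Proof.
move=> der x [+ /nearbyP[c Jc cx]]; rewrite thickening_setCE => rW.
apply/nearbyP; exists c => //; split => // y /nearbyP[_ -> cy]; apply: rW.
exists x => //; have := metric_triangle x (alpha c) y.
by rewrite (metric_sym x (alpha c)); lra.
Qed.

Hypothesis alpha_dense : dense (range alpha).

Lemma dense_nearby x e : (0 < e)%R -> exists c, nearby [set c] e x.
Proof.
move=> e0; have [|y [[_ -> xy] [c _ cy]]] :=
    alpha_dense _ (open_thickening [set x] e).
  by exists x; exact: subset_thickening.
by exists c; apply/nearbyP; exists c => //; rewrite cy metric_sym.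
Qed.

Lemma measure_nearby_cover (mu : {finite_measure set (borel X) -> \bar R})
    (e d : R) : (0 < e)%R -> (0 < d)%R ->
  exists N, mu (~` nearby `I_N e) < d%:E.
Proof.
move=> e0 d0; have [N] := measure_setD_bigcup_II_lt mu
  (fun c => measurable_nearby [set c] e) d0.
rewrite -!nearby_bigcup (_ : nearby setT e = setT).
  by rewrite setTD; exists N.
apply/seteqP; split => // x _; have [c xc] := dense_nearby x e0.
exact: subset_nearby xc.
Qed.

End nearby.

(* Rounding down to multiples of [1 / M] loses at most [1 / M] per term, and
   normalizing the weights only increases them. *)
Lemma nat_weights_approx (R : archiRealFieldType) (N : nat) (p : nat -> R)
    (e : R) :
  (forall i, 0 <= p i) -> 0 < e < \sum_(i < N) p i -> \sum_(i < N) p i <= 1 ->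
  exists w : nat -> nat, (0 < \sum_(i < N) w i)%N /\ forall q : pred nat,
    \sum_(i < N | q i) p i <=
    (\sum_(i < N | q i) w i)%:R / (\sum_(i < N) w i)%:R + e.
Proof.
move=> p0 /andP[e0 ep] p1; pose M := (Num.truncn (N%:R / e)).+1.
have M0 : 0 < M%:R :> R by rewrite ltr0n.
have NM : N%:R <= M%:R * e by rewrite -ler_pdivrMr// ltW// truncnS_gt.
pose w i := Num.truncn (M%:R * p i).
have w_le i : (w i)%:R <= M%:R * p i by rewrite truncn_le mulr_ge0// ltW.
have w_ge i : M%:R * p i <= (w i)%:R + 1 by rewrite natr1 ltW// truncnS_gt.
have wM : (\sum_(i < N) w i)%:R <= M%:R :> R.
  rewrite natr_sum; apply: (@le_trans _ _ (\sum_(i < N) M%:R * p i)).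
    exact: ler_sum.
  by rewrite -mulr_sumr ler_piMr// ltW.
have pw (q : pred nat) :
    M%:R * \sum_(i < N | q i) p i <= (\sum_(i < N | q i) w i)%:R + N%:R.
  rewrite mulr_sumr natr_sum.
  apply: (@le_trans _ _ (\sum_(i < N | q i) ((w i)%:R + 1))).
    exact: ler_sum.
  rewrite big_split /= lerD2l sumr_const ler_nat.
  by rewrite (leq_trans (max_card _))// card_ord.
have w0 : (0 < \sum_(i < N) w i)%N.
  by rewrite -(ltr_nat R); have := pw xpredT; nra.
exists w; split => // q.
apply: (@le_trans _ _ ((\sum_(i < N | q i) w i)%:R / M%:R + e)).
  rewrite -(ler_pM2l M0) mulrDr mulrCA divff ?gt_eqF// mulr1.
  by apply: le_trans (pw q) _; rewrite lerD2l.
by rewrite lerD2r ler_wpM2l// lef_pV2 ?posrE ?ltr0n.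
Qed.

Section finite_support.
Context (R : realType) (X : completeMetricType R) (alpha : nat -> X).
Implicit Types (P : Prob X) (A : set (borel X)).
Local Open Scope ereal_scope.

Lemma finite_measure_of_codeE n A : finite_measure_of_code alpha n A =
  (weight_in (fun c => `[< A (alpha c) >]) n)%:R%:E.
Proof.
rewrite /finite_measure_of_code /msum /weight_in.
rewrite [in RHS]big_mkcond natr_sum -sumEFin.
apply: eq_bigr => i _; rewrite /= /mscale /= diracE.
rewrite -[(_ \in _)]/(`[< A (alpha (atom n i)) >]).
by case: `[< _ >]; rewrite ?mule1 ?mule0.
Qed.

Lemma prob_numE n A : (0 < total_weight n)%N -> prob_num alpha n A =
  ((weight_in (fun c => `[< A (alpha c) >]) n)%:R / (total_weight n)%:R)%:E.
Proof.
move=> n0.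
have mass : finite_measure_of_code alpha n setT = (total_weight n)%:R%:E.
  rewrite finite_measure_of_codeE; congr (_%:R%:E).
  by apply: eq_bigl => i; rewrite asboolT.
have -> : prob_num alpha n A =
  (let m := finite_measure_of_code alpha n setT in
   if (m == 0) || (m == +oo) then fun U => @dirac _ (borel X) (alpha 0%N) R U
   else fun U => finite_measure_of_code alpha n U * (fine m)^-1%:E) A by [].
rewrite mass /= eqe pnatr_eq0 orbF ifF; last by rewrite eqn0Ngt n0.
by rewrite finite_measure_of_codeE.
Qed.

Lemma prob_num_le_half_exp n A M : (0 < total_weight n)%N ->
  (prob_num alpha n A <= (2^-1 ^+ M)%:E) =
  (weight_in (fun c => `[< A (alpha c) >]) n * 2 ^ M <= total_weight n)%N.
Proof.
move=> n0; rewrite prob_numE// lee_fin exprVn ler_pdivrMr ?ltr0n// [leRHS]mulrC.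
by rewrite ler_pdivlMr ?exprn_gt0// -natrX -natrM ler_nat.
Qed.

Definition cell (e : R) : (set (borel X))^nat :=
  seqDU (fun i => nearby alpha [set i] e).

Lemma nearby_cells N e : nearby alpha `I_N e = \big[setU/set0]_(i < N) cell e i.
Proof. by rewrite [LHS]nearby_bigcup bigcup_mkord; exact: bigsetU_seqDU. Qed.

Lemma measurable_cell e i : measurable (cell e i).
Proof. by apply: seqDU_measurable => ?; exact: measurable_nearby. Qed.

Lemma measure_nearby_cells P N e :
  P (nearby alpha `I_N e) = (\sum_(i < N) fine (P (cell e i)))%:E.
Proof.
rewrite nearby_cells measure_bigsetU; last exact: trivIset_seqDU.
  rewrite -sumEFin; apply: eq_bigr => i _.
  by rewrite fineK// fin_num_measure//; exact: measurable_cell.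
exact: measurable_cell.
Qed.

Lemma measure_le_cells P A N e : measurable A ->
  P A <= (\sum_(i < N | `[< thickening A e (alpha i) >])
            fine (P (cell e i)))%:E + P (~` nearby alpha `I_N e).
Proof.
move=> mA; pose F i := if i is j.+1 then
  (if `[< thickening A e (alpha j) >] then cell e j else set0)
  else ~` nearby alpha `I_N e.
have mF i : measurable (F i).
  case: i => [|i]; first by apply: measurableC; exact: measurable_nearby.
  by rewrite /F; case: ifP => // _; exact: measurable_cell.
have AF : A `<=` \big[setU/set0]_(i < N.+1) F i.
  move=> x Ax; rewrite -bigcup_mkord.
  have [|xN] := pselect (nearby alpha `I_N e x); last by exists 0%N.
  rewrite nearby_cells -bigcup_mkord => -[i iN xi]; exists i.+1 => //=.
  rewrite ifT//; apply/asboolP; exists x => //.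
  by have [/nearbyP[_ -> ix] _] := xi; rewrite metric_sym.
apply: le_trans (content_subadditive _ _ mA AF) _ => //.
rewrite big_ord_recl addeC leeD2r// -sumEFin [leRHS]big_mkcond /=.
apply: lee_sum => i _; case: ifP => _; last by rewrite measure0.
by rewrite fineK// fin_num_measure//; exact: measurable_cell.
Qed.

Hypothesis alpha_dense : dense (range alpha).

Lemma prob_num_dense P (e : R) : (0 < e)%R ->
  exists n, (0 < total_weight n)%N /\ (prokhorov P (prob_num alpha n) < e)%R.
Proof.
move=> e0; pose r : R := (Num.min e 1 / 4)%R.
have r0 : (0 < r)%R by rewrite divr_gt0// lt_min e0 ltr01.
have [re r1] : (r + r < e /\ 2 * r < 1)%R.
  have : (Num.min e 1 <= e /\ Num.min e 1 <= 1)%R by rewrite !ge_min !lexx orbT.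
  by rewrite /r; lra.
have [N PN] : exists N, P (~` nearby alpha `I_N (r + r)) < r%:E.
  by apply: measure_nearby_cover => //; exact: addr_gt0.
have mN := measurable_nearby alpha `I_N (r + r).
move: (PN); rewrite probability_setC// measure_nearby_cells -EFinB lte_fin.
move=> p_ge.
have p0 i : (0 <= fine (P (cell (r + r) i)))%R by rewrite fine_ge0.
have p1 : (\sum_(i < N) fine (P (cell (r + r) i)) <= 1)%R.
  by rewrite -lee_fin -measure_nearby_cells probability_le1.
have [|w [w0 wP]] := nat_weights_approx (e := r) p0 _ p1.
  by rewrite r0; lra.
have [n nE] := weight_in_surj N id w.
exists n; rewrite /total_weight nE; split => //; apply: le_lt_trans re.
apply: prokhorov_le => [|A mA]; first exact: addr_gt0.
rewrite prob_numE /total_weight nE// nE.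
apply: le_trans (measure_le_cells P N (r + r) mA) _.
rewrite EFinD addeA; apply: leeD; last exact: ltW.
rewrite -EFinD lee_fin.
exact: (wP (fun i => `[< thickening A (r + r) (alpha i) >])).
Qed.

End finite_support.

(** * Uniform tests *)

Section sup_index.
Context (T : Type) (R : realType).
Implicit Types (A : (set T)^nat) (x : T) (r : R).
Local Open Scope ereal_scope.

Definition sup_index A x : \bar R :=
  ereal_sup (0 |` [set m%:R%:E | m in [set m | A m x]]).

Lemma sup_index_ge0 A x : 0 <= sup_index A x.
Proof. by apply: ereal_sup_ubound; left. Qed.

Lemma le_sup_index A m x : A m x -> m%:R%:E <= sup_index A x.
Proof. by move=> Ax; apply: ereal_sup_ubound; right; exists m. Qed.

Lemma lt_sup_indexP A r x : r%:E < sup_index A x <->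
  (r < 0)%R \/ exists2 m, (r < m%:R)%R & A m x.
Proof.
split=> [/ereal_sup_gt[_ [->|[m Am <-]]]|[r0|[m rm Am]]].
- by rewrite lte_fin; left.
- by rewrite lte_fin; right; exists m.
- by apply: lt_le_trans (sup_index_ge0 _ _); rewrite lte_fin.
- by apply: lt_le_trans (le_sup_index Am); rewrite lte_fin.
Qed.

End sup_index.

Section integral_sup_index.
Context d (T : measurableType d) (R : realType).
Variables (mu : {measure set T -> \bar R}) (A : (set T)^nat).
Hypothesis mA : forall m, measurable (A m).
Local Open Scope ereal_scope.

Lemma measurable_sup_index : measurable_fun [set: T] (sup_index R A).
Proof.
apply: (measurability _ (ErealGenOInfty.measurableE R)) => //.
move=> _ [_ [r ->]] <-; rewrite preimage_itvoy; apply: measurableI => //.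
rewrite (_ : mkset _ = (if (r < 0)%R then setT else set0) `|`
    \bigcup_(m in [set m | (r < m%:R)%R]) A m).
  by apply: measurableU; [case: ifP|exact: bigcup_measurable].
apply/seteqP; split=> x /=.
  by move=> /lt_sup_indexP[->|[m rm Am]]; [left|right; exists m].
by move=> xA; apply/lt_sup_indexP; case: xA => [|[m]];
  [case: ifP => // r0 _; left|right; exists m].
Qed.

Lemma sup_index_le_series x :
  sup_index R A x <= \sum_(m <oo) (m%:R * \1_(A m) x)%:E.
Proof.
have term_ge0 m : 0 <= (m%:R * \1_(A m) x)%:E :> \bar R.
  by rewrite lee_fin mulr_ge0.
apply: ge_ereal_sup => _ [->|[m Am <-]]; first exact: nneseries_ge0.
rewrite (nneseriesD1 (n := m))// indicE mem_set// mulr1.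
by rewrite leeDl// nneseries_ge0.
Qed.

Lemma integral_sup_index_le1 :
  (forall m, mu (A m) <= (2^-1 ^+ (2 * m + 1))%:E) ->
  \int[mu]_x sup_index R A x <= 1.
Proof.
move=> muA.
have mterm m :
    measurable_fun [set: T] (fun x => (m%:R * \1_(A m) x)%:E : \bar R).
  by apply/measurable_EFinP; exact: measurable_funM.
have term_ge0 m x : 0 <= (m%:R * \1_(A m) x)%:E :> \bar R.
  by rewrite lee_fin mulr_ge0.
apply: (@le_trans _ _ (\int[mu]_x \sum_(m <oo) (m%:R * \1_(A m) x)%:E)).
  apply: ge0_le_integral => //.
  - by move=> x _; exact: sup_index_ge0.
  - exact: measurable_sup_index.
  - by apply: ge0_emeasurable_sum.
  - by move=> x _; exact: sup_index_le_series.
rewrite integral_nneseries//.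
apply: le_trans (epsilon_trick0 xpredT ler01).
apply: lee_nneseries => [m _ _|m _]; first exact: integral_ge0.
under eq_integral do rewrite EFinM.
rewrite ge0_integralZl//; last first.
  by apply/measurable_EFinP; exact: measurable_indic.
rewrite integral_indic// setIT; apply: le_trans (lee_wpmul2l _ (muA m)) _ => //.
rewrite -EFinM lee_fin div1r natrX -exprVn.
have -> : (2 * m + 1 = m + m.+1)%N by lia.
rewrite exprD mulrA ler_piMl ?exprn_ge0// exprVn ler_pdivrMr ?exprn_gt0//.
by rewrite mul1r -natrX ler_nat ltnW// ltn_expl.
Qed.

End integral_sup_index.

Section uniform_tests.
Context (R : realType) (X : completeMetricType R) (alpha : nat -> X).
Implicit Types (P Q : Prob X) (x : X) (f t : X -> Prob X -> \bar R).
Implicit Types U : nat -> set (X * Prob X).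
Local Notation mdist := (@mdist R X).
Local Notation mball := (basic_ball (@prokhorov R X) (prob_num alpha)).
Local Open Scope ereal_scope.

Definition uniformly_effectively_open U : Prop :=
  exists2 W : set nat, enumerable W & forall m,
    U m = \bigcup_(n in [set n | W (npair m n)])
      (basic_ball mdist alpha (nfst n) `*` mball (nsnd n)).

Lemma open_basic_ball n : open (basic_ball mdist alpha n).
Proof.
rewrite (_ : basic_ball _ _ n =
    thickening [set alpha (nfst n)] (ratr (rat_num (nsnd n)))).
  exact: open_thickening.
apply/seteqP; split=> [x nx|x [_ -> nx]]; last first.
  by rewrite /basic_ball /= metric_sym.
by exists (alpha (nfst n)) => //; rewrite metric_sym.
Qed.

Lemma open_section U m P : uniformly_effectively_open U ->
  open [set x | U m (x, P)].
Proof.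
move=> [W _ UW]; rewrite (_ : mkset _ =
    \bigcup_(n in [set n | W (npair m n) /\ mball (nsnd n) P])
      basic_ball mdist alpha (nfst n)).
  by apply: bigcup_open => n _; exact: open_basic_ball.
apply/seteqP; split=> x /=; first by rewrite UW => -[n Wn [xn Pn]]; exists n.
by move=> [n [Wn Pn] xn]; rewrite UW; exists n.
Qed.

Lemma lower_semicomputable_semicontinuous f P :
  lower_semicomputable alpha f -> lower_semicontinuous (f^~ P).
Proof.
move=> lf; apply/lower_semicontinuousP => a.
rewrite (_ : mkset _ = \bigcup_(r in [set r | (a <= ratr (rat_num r))%R])
    [set x | (ratr (rat_num r))%:E < f x P]).
  by apply: bigcup_open => r _; exact: (open_section r P lf).
apply/seteqP; split=> x /=; last first.
  by move=> [r /= ar]; apply: le_lt_trans; rewrite lee_fin.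
move=> af; have [v av vf] : exists2 v : R, (a < v)%R & v%:E <= f x P.
  case: (f x P) af => [v av|_|//]; first by exists v.
  by exists (a + 1)%R; rewrite ?ltrDl// leey.
have [q] := rat_in_itvoo av; rewrite in_itv /= => /andP[aq qv].
have [r rq] := rat_num_surj q; exists r; rewrite /= rq; first exact: ltW.
by apply: lt_le_trans vf; rewrite lte_fin.
Qed.

Lemma uniform_test_infty_null f P : uniform_test alpha f ->
  measurable [set x : borel X | f x P = +oo] /\
  P [set x : borel X | f x P = +oo] = 0.
Proof.
move=> [f0 lf intf].
have mf := lower_semicontinuous_borel_measurable
  (lower_semicomputable_semicontinuous (P := P) lf).
have mfoo : measurable [set x : borel X | f x P = +oo].
  have := emeasurable_fun_c_infty measurableT mf +oo; rewrite setTI.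
  by congr measurable; apply/seteqP; split=> x /=; rewrite leye_eq => /eqP.
split => //.
have : P.-integrable setT (fun x : borel X => f x P).
  apply/integrableP; split => //.
  under eq_integral do rewrite gee0_abs//.
  by apply: le_lt_trans (intf P) _; rewrite ltry.
move=> /integrable_ae[//|N [mN PN0 fN]]; apply: subset_measure0 PN0 => //.
by move=> x /= fx; apply: fN => /= /(_ I); rewrite fx.
Qed.

Lemma effectively_orthogonal_orthogonal t P Q : uniform_test alpha t ->
  effectively_orthogonal t P Q -> orthogonal_measures P Q.
Proof.
move=> ut tPQ; have [mP P0] := uniform_test_infty_null P ut.
have [mQ Q0] := uniform_test_infty_null Q ut.
exists (~` [set x | t x P = +oo]), [set x | t x P = +oo]; split => //.
- exact: measurableC.
- by rewrite setUC setUv.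
- by rewrite setIC setICr.
split => //; apply: subset_measure0 Q0 => //; first exact: measurableC.
move=> x /= tP; apply: contrapT => tQ; apply: tPQ; exists x.
by split; rewrite /uniformly_random ltey; apply/eqP.
Qed.

(* The rate of decay is chosen such that the sum of all [m * 2^-(2m+1)] is at
   most 1, as needed in [integral_sup_index_le1]. *)
Record uniform_sequential_test U : Prop := {
  sequential_test_open : uniformly_effectively_open U ;
  sequential_test_small : forall m P,
    P [set x : borel X | U m (x, P)] <= (2^-1 ^+ (2 * m + 1))%:E
}.

Lemma basic_ball_product_cover x P :
  exists n, basic_ball mdist alpha (nfst n) x /\ mball (nsnd n) P.
Proof.
pose N := (Num.truncn (mdist x (alpha 0%N))).+1.
exists (npair (npair 0 (npair (npair N 0) 0)) (npair 0 (npair (npair 2 0) 0))).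
rewrite /basic_ball /= !npairE !ratr_rat_numE !npairE !subr0 !divr1.
split; first exact: truncnS_gt.
by apply: le_lt_trans (prokhorov_le1 _ _) _; rewrite ltr1n.
Qed.

Lemma lower_semicomputable_sup_index U : uniformly_effectively_open U ->
  lower_semicomputable alpha (fun x P => sup_index R U (x, P)).
Proof.
move=> [W /enumerableP[p rp WE] UW].
pose r_lt0 w := rat_lt_dyadic (nfst w) 0 0.
pose listed_above w z := rat_lt_dyadic (nfst w) (nfst z) 0 &&
  p (npair (nfst z) (nsnd w)) (nsnd z).
exists [set w | exists z, r_lt0 w || listed_above w z].
  apply/enumerableP; exists (fun w z => r_lt0 w || listed_above w z) => //.
  by rewrite /r_lt0 /listed_above; prove_recursive.
move=> r; apply/seteqP; split=> -[x P] /=.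
  move=> /lt_sup_indexP[r0|[m rm]].
    have [n [xn Pn]] := basic_ball_product_cover x P; exists n => //=.
    by exists 0%N; rewrite /r_lt0 npairE (rat_lt_dyadicE R) mul0r r0.
  rewrite UW WE => -[n [y py] xPn]; exists n => //.
  exists (npair m y); rewrite /listed_above !npairE (rat_lt_dyadicE R).
  by rewrite expr0 mulr1 rm py orbT.
move=> [n [z]]; rewrite /r_lt0 /listed_above !npairE !(rat_lt_dyadicE R).
rewrite mul0r expr0 mulr1 => nz xPn; apply/lt_sup_indexP; move: nz.
move=> /orP[|/andP[rz pz]]; [by left|right; exists (nfst z) => //].
by rewrite UW WE; exists n => //; exists (nsnd z).
Qed.

Lemma uniform_test_sup_index U : uniform_sequential_test U ->
  uniform_test alpha (fun x P => sup_index R U (x, P)).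
Proof.
move=> [oU smallU]; split.
- by move=> x P; exact: sup_index_ge0.
- exact: lower_semicomputable_sup_index.
move=> P; apply: (@integral_sup_index_le1 _ (borel X) R P
  (fun m => [set x | U m (x, P)])) => m; last exact: smallU.
by apply: borel_open; exact: open_section.
Qed.

Lemma uniformly_random_bounded U t x P : universal_uniform_test alpha t ->
  uniform_sequential_test U -> uniformly_random t x P ->
  exists N, forall m, U m (x, P) -> (m <= N)%N.
Proof.
move=> [ut tmax] /uniform_test_sup_index/tmax[C C0 /(_ x P) supC] txP.
have tfin : t x P \is a fin_num.
  by rewrite ge0_fin_numE//; exact: uniform_test_ge0 ut _ _.
exists (Num.truncn (C * fine (t x P))) => m mU.
rewrite -ltnS -(ltr_nat R); apply: le_lt_trans (truncnS_gt _).
rewrite -lee_fin EFinM fineK//; apply: le_trans supC.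
exact: (@le_sup_index _ R (fun m => U m)).
Qed.

End uniform_tests.

(** * Separation of orthogonal measures *)

Section separation.
Context (R : realType) (X : completeMetricType R) (alpha : nat -> X).
Hypothesis alpha_dense : dense (range alpha).
Local Open Scope ereal_scope.

Lemma open_nearby_inner (mu : {finite_measure set (borel X) -> \bar R})
    (W : set X) (L d : R) (M : nat) : open W -> (0 <= L)%R -> (0 < d)%R ->
  exists k (I : set nat), [/\ (M <= k)%N, finite_set I,
    nearby alpha I (L * 2^-1 ^+ k) `<=` W &
    mu (W `\` nearby alpha I (2^-1 ^+ k)) < d%:E].
Proof.
move=> oW L0 d0; have d20 : (0 < d / 2)%R by rewrite divr_gt0.
have half_gt0 : (0 < 2^-1 :> R)%R by lra.
pose F n : set (borel X) := ~` thickening (~` W) (2^-1 ^+ n).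
have mF n : measurable (F n).
  by apply: measurableC; exact: measurable_thickening.
have [n] := nondecreasing_measure_setD_lt mu mF
  (nondecreasing_thickening_setC W) d20.
rewrite open_bigcup_thickening_setC// => WF.
have [k Mk kn] := half_exp_mul_le M (ltr_wpDl L0 ltr01)
  (exprn_gt0 n half_gt0).
have [N cover] :=
  measure_nearby_cover alpha_dense mu (exprn_gt0 k half_gt0) d20.
pose I := `I_N `&` [set c | nearby alpha [set c] (L * 2^-1 ^+ k) `<=` W].
exists k, I; split => //.
- exact: finite_setIl (finite_II N).
- by rewrite nearby_bigcup => x [c [_]]; exact.
have mW : measurable (W : set (borel X)) by exact: borel_open.
have mI := measurable_nearby alpha I (2^-1 ^+ k).
have mN := measurable_nearby alpha `I_N (2^-1 ^+ k).
have mWF : measurable (W `\` F n : set (borel X)) by exact: measurableD.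
rewrite [d]splitr EFinD; apply: le_lt_trans (lteD WF cover).
apply: le_trans (measureU2 _ mWF (measurableC mN)).
apply: le_measure; rewrite ?inE; [exact: measurableD|
  by apply: measurableU => //; exact: measurableC|].
move=> x [Wx xI]; have [Fx|Fx] := pselect (F n x); last by left.
right=> xN; apply: xI; apply: eroded_nearby_subset (conj Fx xN).
by rewrite -[X in (_ + X)%R]mul1r -mulrDl.
Qed.

Lemma orthogonal_separation (P Q : Prob X) (L d : R) (M : nat) :
  orthogonal_measures P Q -> (0 <= L)%R -> (0 < d)%R ->
  exists k (I : set nat), [/\ (M <= k)%N, finite_set I,
    P (nearby alpha I (L * 2^-1 ^+ k)) < d%:E &
    Q (~` nearby alpha I (2^-1 ^+ k)) < d%:E].
Proof.
move=> [U [V [mU mV UV _ [PV QU]]]] L0 d0.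
have [W [oW VW PWV]] := borel_outer_regular P mV d0.
have mW := borel_open oW.
have PW : P (W : set (borel X)) < d%:E.
  have PWV0 : P (W `&` V : set (borel X)) = 0.
    by apply: subset_measure0 PV => //; exact: measurableI.
  by rewrite (measureDI P mW mV) [X in _ + X]PWV0 adde0.
have QW : Q (~` W : set (borel X)) = 0.
  apply: subset_measure0 QU => //; first exact: measurableC.
  by move=> x Wx; have : (U `|` V) x by [rewrite UV]; case=> // /VW.
have [k [I [Mk finI IW QI]]] := open_nearby_inner Q M oW L0 d0.
have mI e := measurable_nearby alpha I e.
exists k, I; split => //.
  by apply: le_lt_trans PW; apply: le_measure; rewrite ?inE.
apply: le_lt_trans QI; rewrite -[leRHS]adde0 -QW.
apply: le_trans (measureU2 _ _ (measurableC mW)); last exact: measurableD.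
apply: le_measure; rewrite ?inE; [exact: measurableC|
  by apply: measurableU; [exact: measurableD|exact: measurableC]|].
by move=> x xI; have [Wx|Wx] := pselect (W x); [left|right].
Qed.

End separation.

(** * Effective separation *)

Lemma basic_ball_radius_code (R : realType) (T : Type) (dist : T -> T -> R)
    (center : nat -> T) (k n : nat) : nsnd n = radius_code k ->
  basic_ball dist center n = [set x | dist x (center (nfst n)) < 2^-1 ^+ k].
Proof. by rewrite /basic_ball => ->; rewrite ratr_radius_code. Qed.

(* A ball of measures with radius [2^-k] whose center gives mass at most
   [2^-M] to the atoms satisfying [p]. *)
Definition light_ball (p : pred nat) (M k n : nat) : bool :=
  [&& nsnd n == radius_code k, 0 < total_weight (nfst n) &
      weight_in p (nfst n) * 2 ^ M <= total_weight (nfst n)]%N.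

Section light_balls.
Context (R : realType) (X : completeMetricType R) (alpha : nat -> X).
Implicit Types (P : Prob X) (S T : pred nat) (M k n : nat).
Local Notation mdist := (@mdist R X).
Local Notation mball := (basic_ball (@prokhorov R X) (prob_num alpha)).
Local Open Scope ereal_scope.

Lemma light_ball_nearby_le P S T M k n : (M < k)%N ->
  (forall c a, S c -> (mdist (alpha c) (alpha a) < 2 * 2^-1 ^+ k)%R -> T a) ->
  light_ball T M.+1 k n -> mball n P ->
  P (nearby alpha [set c | S c] (2^-1 ^+ k)) <= (2^-1 ^+ M)%:E.
Proof.
move=> Mk ST /and3P[/eqP nk n0 nT].
rewrite (basic_ball_radius_code _ _ nk) => /prokhorov_lt Pn.
apply: le_trans (Pn _ (measurable_nearby _ _ _)) _.
rewrite (half_exp_split _ M) EFinD; apply: leeD; last first.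
  by rewrite lee_fin half_exp_le.
rewrite prob_num_le_half_exp//; apply: leq_trans nT; rewrite leq_mul2r.
apply/orP; right; apply: leq_weight_in => a /asboolP[x /nearbyP[c Sc cx] xa].
by apply: (ST c) => //; have := metric_triangle (alpha c) x (alpha a); lra.
Qed.

Lemma exists_light_ball P T M k : dense (range alpha) -> (M < k)%N ->
  P (nearby alpha [set c | T c] (2 * 2^-1 ^+ k)) < (2^-1 ^+ M.+1)%:E ->
  exists2 n, light_ball T M k n & mball n P.
Proof.
move=> alpha_dense Mk PT; set e : R := (2^-1 ^+ k)%R in PT *.
have e0 : (0 < e)%R by rewrite exprn_gt0.
have [n [n0 Pn]] := prob_num_dense alpha_dense P e0.
exists (npair n (radius_code k)); last first.
  by rewrite (@basic_ball_radius_code _ _ _ _ k) ?npairE.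
rewrite /light_ball !npairE eqxx n0 /=.
have mT := measurable_nearby alpha [set c | T c] e.
have := Pn; rewrite prokhorovC => /prokhorov_lt/(_ mT) nP.
have : prob_num alpha n (nearby alpha [set c | T c] e) <= (2^-1 ^+ M)%:E.
  apply: le_trans nP _; rewrite (half_exp_split _ M) EFinD.
  apply: leeD; last by rewrite lee_fin half_exp_le.
  apply: le_trans (ltW PT); apply: le_measure; rewrite ?inE.
  - exact: measurable_thickening.
  - exact: measurable_nearby.
  - by have -> : (2 * e = e + e)%R by [lra]; exact: thickening_thickening.
rewrite prob_num_le_half_exp//; apply: leq_trans; rewrite leq_mul2r.
apply/orP; right.
by apply: leq_weight_in => c Tc; apply/asboolP; exact: subset_thickening.
Qed.

End light_balls.

Definition approximates_mdist (R : realType) (X : completeMetricType R)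
    (alpha : nat -> X) (delta : nat -> nat) : Prop :=
  forall m n k, `| mdist (alpha m) (alpha n) -
    ratr (rat_num (delta (npair (npair m n) k))) | <= 2^-1 ^+ k :> R.

Section near_listed.
Context (R : realType) (X : completeMetricType R) (alpha : nat -> X).
Variable delta : nat -> nat.
Implicit Types L k I a c : nat.
Local Notation mdist := (@mdist R X).

Definition near_listed L k I a : bool :=
  has (fun j => rat_lt_dyadic
         (delta (npair (npair a (atom_entry (nsnd I) j)) k)) L k)
      (iota 0 (nfst I)).

Lemma recursive_near_listed L (k I a : nat -> nat) : recursive delta ->
  recursive k -> recursive I -> recursive a ->
  recursive (fun x => near_listed L (k x) (I x) (a x)).
Proof. by move=> rd rk rI ra; rewrite /near_listed; prove_recursive. Qed.

Hypothesis deltaP : approximates_mdist alpha delta.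

Lemma near_listedP L k I a : reflect
  (exists2 c, listed I c &
     ratr (rat_num (delta (npair (npair a c) k))) < L%:R * 2^-1 ^+ k :> R)
  (near_listed L k I a).
Proof.
apply: (iffP hasP) => [[j]|[_ [j jI <-] dj]].
  rewrite mem_iota add0n => /= jI dj.
  by exists (atom_entry (nsnd I) j); [exists j|rewrite -rat_lt_dyadicE].
by exists j; [rewrite mem_iota|rewrite (rat_lt_dyadicE R)].
Qed.

Lemma near_listed_nearby L k I a : near_listed L k I a ->
  nearby alpha (listed I) (L.+1%:R * 2^-1 ^+ k) (alpha a).
Proof.
move=> /near_listedP[c Ic ac]; apply/nearbyP; exists c => //.
have := deltaP a c k; rewrite ler_distlC metric_sym => /andP[+ _].
by rewrite -[L.+1%:R]natr1 mulrDl mul1r; lra.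
Qed.

Lemma nearby_near_listed L k I a :
  nearby alpha (listed I) (L%:R * 2^-1 ^+ k) (alpha a) ->
  near_listed L.+1 k I a.
Proof.
move=> /nearbyP[c Ic ca]; apply/near_listedP; exists c => //.
have := deltaP a c k; rewrite ler_distlC metric_sym => /andP[_].
by rewrite -[L.+1%:R]natr1 mulrDl mul1r; lra.
Qed.

Lemma near_listed_close L k I a c : near_listed L k I a ->
  mdist (alpha a) (alpha c) < 2 * 2^-1 ^+ k -> near_listed L.+4 k I c.
Proof.
move=> /near_listed_nearby/nearbyP[i Ii ia] ac.
apply: nearby_near_listed; apply/nearbyP; exists i => //.
have := metric_triangle (alpha i) (alpha a) (alpha c).
by rewrite -addn2 -addn1 natrD mulrDl; lra.
Qed.

End near_listed.
#[local] Hint Resolve recursive_near_listed : recursive.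

Section separates.
Local Open Scope nat_scope.
Variables (delta p q : nat -> nat).

(* A witness [<k, <I, <u, v>>>] consists of a scale [2^-k], a list [I] of points
   of [D], and the indices of the balls [p u] and [q v] of measures. *)
Definition scale (z : nat) : nat := nfst z.
Definition list_code (z : nat) : nat := nfst (nsnd z).
Definition left_ball (z : nat) : nat := p (nfst (nsnd (nsnd z))).
Definition right_ball (z : nat) : nat := q (nsnd (nsnd (nsnd z))).

Definition near_witness (L z : nat) : pred nat :=
  near_listed delta L (scale z) (list_code z).

(* The thresholds leave room for [near_listed_close]: the points within
   [2 * 2^-k] of a point that satisfies [near_witness 8] satisfy
   [near_witness 12], and those within [2 * 2^-k] of a point that does not
   satisfy it do not satisfy [near_witness 4]. *)
Definition separates (m z : nat) : bool :=
  [&& 2 * m + 2 <= scale z,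
      light_ball (near_witness 12 z) (2 * m + 2) (scale z) (left_ball z) &
      light_ball (fun a => ~~ near_witness 4 z a) (2 * m + 2) (scale z)
        (right_ball z)].

Lemma recursive_separates : recursive delta -> recursive p -> recursive q ->
  recursive2 (fun m z => separates m z).
Proof.
move=> rd rp rq; rewrite /separates /light_ball /near_witness /=.
by rewrite /left_ball /right_ball /scale /list_code; prove_recursive.
Qed.

End separates.

Section separation_witness.
Context (R : realType) (X : completeMetricType R) (alpha : nat -> X).
Local Notation mball := (basic_ball (@prokhorov R X) (prob_num alpha)).

Definition nearby_times_ball (k b : nat -> nat) (S : nat -> pred nat) (m : nat)
    : set (X * Prob X) :=
  (nearby alpha [set c | S m c] (2^-1 ^+ k m) : set X) `*` mball (b m).

Lemma uniformly_effectively_open_nearby_times_ball (k b : nat -> nat)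
    (S : nat -> pred nat) :
  recursive k -> recursive b -> recursive2 (fun m c => S m c) ->
  uniformly_effectively_open alpha (nearby_times_ball k b S).
Proof.
move=> rk rb rS; pose code m n := [&& nsnd (nfst n) == radius_code (k m),
  S m (nfst (nfst n)) & nsnd n == b m].
exists [set w | exists z : nat, code (nfst w) (nsnd w)].
  apply/enumerableP; exists (fun w _ => code (nfst w) (nsnd w)) => //.
  by rewrite /code; prove_recursive.
move=> m; apply/seteqP; split=> -[x P] /=.
  move=> [/nearbyP[c Sc cx] bP].
  exists (npair (npair c (radius_code (k m))) (b m)).
    by exists 0%N; rewrite /code !npairE !eqxx (Sc : S m c).
  split; rewrite /= npairE //.
  by rewrite (@basic_ball_radius_code _ _ _ _ (k m)) ?npairE//= metric_sym.
move=> [n [_]]; rewrite /code !npairE => /and3P[/eqP nk Sn /eqP nb].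
rewrite nb (basic_ball_radius_code _ _ nk) => -[xn bP]; split => //.
by apply/nearbyP; exists (nfst (nfst n)) => //; rewrite metric_sym.
Qed.

Lemma uniform_sequential_test_nearby_times_ball (k b : nat -> nat)
    (S : nat -> pred nat) :
  recursive k -> recursive b -> recursive2 (fun m c => S m c) ->
  (forall m P, mball (b m) P ->
    P (nearby alpha [set c | S m c] (2^-1 ^+ k m)) <=
    (2^-1 ^+ (2 * m + 1))%:E)%E ->
  uniform_sequential_test alpha (nearby_times_ball k b S).
Proof.
move=> rk rb rS small; split=> [|m P].
  exact: uniformly_effectively_open_nearby_times_ball.
have [bP|bP] := pselect (mball (b m) P).
  apply: le_trans (small m P bP); apply: le_measure; rewrite ?inE.
  - apply: borel_open; apply: open_section.
    exact: uniformly_effectively_open_nearby_times_ball.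
  - exact: measurable_nearby.
  - by move=> x [].
rewrite (_ : mkset _ = set0) ?measure0 ?lee_fin ?exprn_ge0//.
by rewrite -subset0 => x [].
Qed.

Lemma computable_measure_balls (P : Prob X) : computable_measure alpha P ->
  exists2 p, recursive p & range p = [set n | mball n P].
Proof.
move=> [ball0|//]; exfalso.
have [n [_ nP]] := basic_ball_product_cover alpha (alpha 0%N) P.
by have : [set n | mball n P] (nsnd n) by []; rewrite ball0.
Qed.

Hypothesis hX : constructive_metric_space alpha.
Variable delta : nat -> nat.
Hypothesis deltaP : approximates_mdist alpha delta.
Variables (P Q : Prob X) (p q : nat -> nat).
Hypothesis pP : range p = [set n | mball n P].
Hypothesis qQ : range q = [set n | mball n Q].

Lemma exists_separates m : orthogonal_measures P Q ->
  exists z, separates delta p q m z.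
Proof.
move=> PQ; pose M := (2 * m + 2)%N.
have d0 : 0 < 2^-1 ^+ M.+1 :> R by rewrite exprn_gt0.
have [k [A [Mk finA PA QA]]] :=
  orthogonal_separation (alpha_dense hX) M.+1 PQ (ler0n R 15) d0.
have [I IA] := listed_surj finA; rewrite -{}IA in PA QA.
pose near L := near_listed delta L k I.
have Pnear : (P (nearby alpha [set c | near 12%N c] (2 * 2^-1 ^+ k)) <
    (2^-1 ^+ M.+1)%:E)%E.
  apply: le_lt_trans PA; apply: le_measure; rewrite ?inE.
  - exact: measurable_nearby.
  - exact: measurable_nearby.
  move=> x /nearbyP[c /(near_listed_nearby deltaP)/nearbyP[i Ii ic] cx].
  apply/nearbyP; exists i => //.
  by have := metric_triangle (alpha i) (alpha c) x; lra.
have Qfar : (Q (nearby alpha [set c | ~~ near 4%N c] (2 * 2^-1 ^+ k)) <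
    (2^-1 ^+ M.+1)%:E)%E.
  apply: le_lt_trans QA; apply: le_measure; rewrite ?inE.
  - exact: measurable_nearby.
  - by apply: measurableC; exact: measurable_nearby.
  move=> x /nearbyP[c far cx] /nearbyP[i Ii ix]; move: far => /negP; apply.
  apply: (nearby_near_listed deltaP); apply/nearbyP; exists i => //.
  have := metric_triangle (alpha i) x (alpha c).
  by rewrite (metric_sym x (alpha c)); lra.
have [b pb bP] := exists_light_ball (alpha_dense hX) Mk Pnear.
have [c qc cQ] := exists_light_ball (alpha_dense hX) Mk Qfar.
have [u _ ub] : range p b by rewrite pP.
have [v _ vc] : range q c by rewrite qQ.
exists (npair k (npair I (npair u v))).
rewrite /separates /near_witness /left_ball /right_ball /scale /list_code.
by rewrite !npairE ub vc pb qc (ltnW Mk).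
Qed.

Lemma separates_nearby_le m z (P' : Prob X) : separates delta p q m z ->
  (mball (left_ball p z) P' ->
     P' (nearby alpha [set c | near_witness delta 8 z c] (2^-1 ^+ scale z)) <=
     (2^-1 ^+ (2 * m + 1))%:E)%E /\
  (mball (right_ball q z) P' ->
     P' (nearby alpha [set c | ~~ near_witness delta 8 z c]
       (2^-1 ^+ scale z)) <= (2^-1 ^+ (2 * m + 1))%:E)%E.
Proof.
rewrite /separates addn2 -addn1 -[(2 * m).+1]addn1 addn1.
move=> /and3P[mz left_light right_light].
split.
  apply: light_ball_nearby_le left_light => // c a near8 ca.
  exact: near_listed_close ca.
apply: light_ball_nearby_le right_light => // c a far8 ca.
apply: contraNN far8 => near4; apply: (near_listed_close deltaP near4).
by rewrite metric_sym.
Qed.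

End separation_witness.

Lemma effective_separation (R : realType) (X : completeMetricType R)
    (alpha : nat -> X) (hX : constructive_metric_space alpha) (P Q : Prob X) :
  computable_measure alpha P -> computable_measure alpha Q ->
  orthogonal_measures P Q ->
  exists U V : nat -> set (X * Prob X),
    [/\ uniform_sequential_test alpha U, uniform_sequential_test alpha V &
        forall m x, U m (x, P) \/ V m (x, Q)].
Proof.
move=> /computable_measure_balls[p rp pP] /computable_measure_balls[q rq qQ] PQ.
have [delta rdelta deltaP] := alpha_computable hX.
have [h rh hsep] := recursive_selection (recursive_separates rdelta rp rq)
  (fun m => exists_separates hX deltaP pP qQ m PQ).
pose near m := near_witness delta 8 (h m); pose far m c := ~~ near m c.
pose k m := scale (h m).
pose b m := left_ball p (h m); pose c m := right_ball q (h m).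
have rk : recursive k by rewrite /k /scale; prove_recursive.
have rb : recursive b by rewrite /b /left_ball; prove_recursive.
have rc : recursive c by rewrite /c /right_ball; prove_recursive.
have rnear : recursive2 (fun m a => near m a).
  by rewrite /near /near_witness /scale /list_code; prove_recursive.
have rfar : recursive2 (fun m a => far m a) by exact: recursive_negb.
exists (nearby_times_ball alpha k b near), (nearby_times_ball alpha k c far).
split.
- apply: uniform_sequential_test_nearby_times_ball => // m P'.
  exact: (separates_nearby_le deltaP P' (hsep m)).1.
- apply: uniform_sequential_test_nearby_times_ball => // m P'.
  exact: (separates_nearby_le deltaP P' (hsep m)).2.
move=> m x; have e0 : 0 < 2^-1 ^+ k m :> R by rewrite exprn_gt0.
have [a xa] := dense_nearby (alpha_dense hX) x e0.
have [ma|ma] := boolP (near m a); [left|right]; split.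
- by apply: subset_nearby xa => _ ->.
- by have : range p (b m) by [eexists]; rewrite pP.
- by apply: subset_nearby xa => _ ->.
- by have : range q (c m) by [eexists]; rewrite qQ.
Qed.

Lemma orthogonal_effectively_orthogonal (R : realType)
    (X : completeMetricType R) (alpha : nat -> X)
    (hX : constructive_metric_space alpha) (t : X -> Prob X -> \bar R)
    (P Q : Prob X) : universal_uniform_test alpha t ->
  computable_measure alpha P -> computable_measure alpha Q ->
  orthogonal_measures P Q -> effectively_orthogonal t P Q.
Proof.
move=> ht hP hQ PQ [x [tP tQ]].
have [U [V [testU testV cover]]] := effective_separation hX hP hQ PQ.
have [NP UP] := uniformly_random_bounded ht testU tP.
have [NQ VQ] := uniformly_random_bounded ht testV tQ.
by have [/UP|/VQ] := cover (maxn NP NQ).+1 x; rewrite leqNgt ltnS;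
  rewrite ?leq_maxl ?leq_maxr.
Qed.

Theorem theorem25 (R : realType) (X : completeMetricType R) (alpha : nat -> X)
    (hX : constructive_metric_space alpha)
    (t : X -> Prob X -> \bar R) (ht : universal_uniform_test alpha t)
    (P Q : Prob X)
    (hP : computable_measure alpha P) (hQ : computable_measure alpha Q) :
  orthogonal_measures P Q <-> effectively_orthogonal t P Q.
Proof.
split; first exact: (orthogonal_effectively_orthogonal hX ht hP hQ).
exact: effectively_orthogonal_orthogonal ht.1.
Qed.
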